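(* Let $(X,T)$ be a topological dynamical system and $\mu\in M(X,T)$. The following are equivalent: (i) $(X,\mathcal{B},\mu,T)$ is rigid; (ii) there exists a subsequence $A$ of $\mathbb{N}$ such that $(X,T)$ is $\mu$-$A$-equicontinuous; (iii) there exists an IP-set $A\subset\mathbb{N}$ such that $(X,T)$ is $\mu$-$A$-equicontinuous.
   Context: A topological dynamical system $(X,T)$ is a non-empty compact metric space $X$ with metric $d$ together with a homeomorphism $T:X\to X$. $\mathcal{B}$ is the Borel $\sigma$-algebra of $X$ and $M(X,T)$ is the set of $T$-invariant regular Borel probability measures on $X$. $\mathbb{N}$ denotes the non-negative integers. A subsequence $A=\{a_i:i\in\mathbb{N}\}$ of $\mathbb{N}$ is an infinite set of natural numbers listed in strictly increasing order. $(X,\mathcal{B},\mu,T)$ is rigid if there is a subsequence $\{t_k\}$ of $\mathbb{N}$ such that $f\circ T^{t_k}\to f$ in $L^2(\mu)$ for all $f\in L^2(\mu)$. For a sequence $\{b_i:i\in\mathbb{N}\}$ of positive integers let $FS\{b_i\}=\{b_{i_1}+\cdots+b_{i_k}: i_1<\cdots<i_k,\ k\geq 1\}$. A set $F\subset\mathbb{N}$ is an IP-set if $F=FS\{b_i\}$ for some such $\{b_i\}$; an IP-set is regarded as a subsequence of $\mathbb{N}$ by listing its elements in increasing order. For a subsequence $A=\{a_i\}$ of $\mathbb{N}$, a subset $K\subset X$ is $A$-equicontinuous if for every $\epsilon>0$ there is $\delta>0$ such that for all $x,y\in K$ with $d(x,y)<\delta$ one has $d(T^{a_n}x,T^{a_n}y)<\epsilon$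 for all $n\in\mathbb{N}$. $(X,T)$ is $\mu$-$A$-equicontinuous if for every $\tau>0$ there is a compact $A$-equicontinuous set $K\subset X$ with $\mu(K)>1-\tau$. *)

(* Defs.v *)
From HB Require Import structures.
From mathcomp Require Import all_boot all_order all_algebra.
From mathcomp Require Import all_classical all_reals all_analysis.

Set Implicit Arguments.
Unset Strict Implicit.
Unset Printing Implicit Defensive.

Import Order.TTheory GRing.Theory Num.Theory.
Import numFieldNormedType.Exports.

Local Open Scope classical_set_scope.
Local Open Scope ring_scope.

(* The distinguished point only records non-emptiness; it is needed because
   [measurableType] inherits from [pointedType]. *)
#[short(type="pmetricType")]
HB.structure Definition PointedMetric (K : numDomainType) :=
  { M of Metric K M & Pointed M }.

Notation borelType X := (g_sigma_algebraType (@open X)).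

Definition homeomorphism (X Y : topologicalType) (T : X -> Y) : Prop :=
  continuous T /\
  exists S : Y -> X, [/\ continuous S, cancel T S & cancel S T].

Definition invariant_measure d (X : measurableType d) (R : realType)
    (mu : probability X R) (T : X -> X) : Prop :=
  forall B : set X, measurable B -> mu (T @^-1` B) = mu B.

Definition regular_measure (R : realType) (X : pmetricType R)
    (mu : probability (borelType X) R) : Prop :=
  forall B : set (borelType X), measurable B ->
    mu B = ereal_inf [set mu U | U in [set U : set X | open U /\ B `<=` U]] /\
    mu B = ereal_sup [set mu K | K in [set K : set X | compact K /\ K `<=` B]].

(* The set M(X, T). *)
Definition invariant_regular (R : realType) (X : pmetricType R) (T : X -> X) :
    set (probability (borelType X) R) :=
  [set mu : probability (borelType X) R |
    invariant_measure mu T /\ regular_measure mu].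

(* An infinite subset of nat is represented by its increasing enumeration. *)
Definition subsequence (a : nat -> nat) : Prop := increasing_seq a.

(* [Lfun mu 2%:E] consists of representatives of the classes in L^2(mu);
   [T] preserves [mu], so composition with [T] respects a.e. equality. *)
Definition rigid d (X : measurableType d) (R : realType)
    (mu : probability X R) (T : X -> X) : Prop :=
  exists t : nat -> nat, subsequence t /\
    forall f : X -> R, f \in Lfun mu 2%:E ->
      ('N[mu]_2%:E [EFin \o (f \o iter (t k) T \- f)%R])%E @[k --> \oo] --> 0%E.

Definition FS (b : nat -> nat) : set nat :=
  [set (\sum_(i <- s) b i)%N |
    s in [set s : seq nat | s != [::] /\ sorted ltn s]].

Definition IP_set (F : set nat) : Prop :=
  exists b : nat -> nat, (forall i, (0 < b i)%N) /\ F = FS b.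

Definition equicontinuous_along (R : realType) (X : pmetricType R)
    (T : X -> X) (a : nat -> nat) (K : set X) : Prop :=
  forall eps : R, 0 < eps -> exists2 delta : R, 0 < delta &
    forall x y : X, K x -> K y -> mdist x y < delta ->
      forall n : nat, mdist (iter (a n) T x) (iter (a n) T y) < eps.

Definition measure_equicontinuous_along (R : realType) (X : pmetricType R)
    (mu : probability (borelType X) R) (T : X -> X) (a : nat -> nat) : Prop :=
  forall tau : R, 0 < tau -> exists K : set X,
    [/\ compact K, equicontinuous_along T a K & ((1 - tau)%:E < mu K)%E].

(* Main.v *)
Require Import Defs.
From mathcomp Require Import all_boot all_order all_algebra.
From mathcomp Require Import all_classical all_reals all_analysis.
From mathcomp Require Import measurable_realfun.
From mathcomp Require Import ring lra zify.

(** All three conditions are equivalent to recurrence in measure: for every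
    [e > 0] there are arbitrarily large [n] with
    [mu {x | d (T^n x, x) > e} <= e].

    - Rigidity gives recurrence ([rigid_recurrent]). Cover [X] by finitely many
      balls [B] of radius [e / 2]. A point displaced by more than [e] lies in
      one of these balls and its image leaves it, so the measure of the
      displaced points is at most the sum of the numbers
      [|1_B \o T^n - 1_B|^2] (norms in [L^2]), which are small along the
      rigidity sequence.

    - Recurrence gives rigidity ([recurrent_rigid]). If a continuous
      measure-preserving [S] moves most points very little, regularity shows
      that [B] and [S^-1 B] almost coincide for a Borel set [B]
      ([near_identity_set]). Hence [f \o S] is [L^2]-close to [f] when [f] is a
      scaled indicator, then when [f] is simple, and, as [f |-> f \o S] is an
      isometry, for every [f] in [L^2] ([asymptotically_fixed_L2]).

    - Equicontinuity along [a] on a large compact [K] gives recurrence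
      ([equicontinuous_recurrent]). As in the theorem of Arzela and Ascoli the
      maps [T^(a n)] restricted to [K] are totally bounded for the uniform
      distance, so two of them, with indices far apart, are uniformly
      [e]-close on [K]; by invariance [T^(a n - a m)] displaces by [e] or more
      only a set of measure at most [mu (~` K)].

    - Recurrence gives an IP-set ([recurrent_IP]). Choose the generators [b k]
      one after the other so that, outside a set [D k] with
      [mu (D k) <= 2^-k], the point [T^(b k) x] is so near [x] that the maps
      [T^j], for [j] up to [b 0 + ... + b (k-1)], keep the two points
      [2^-k]-close. If [x] avoids all [D k] with [k >= M], then deleting from a
      finite sum of the [b k] the terms of index [>= M] moves the corresponding
      iterate of [x] by at most [2 * 2^-M]. What remains is one of finitely
      many iterates, which are uniformly continuous. *)

Set Implicit Arguments.
Unset Strict Implicit.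
Unset Printing Implicit Defensive.

Import Order.TTheory GRing.Theory Num.Theory.
Import numFieldNormedType.Exports.

Local Open Scope classical_set_scope.
Local Open Scope ring_scope.

(** * Compactness in metric spaces *)

Section Metric.
Context {R : realType} {X : pmetricType R}.
Implicit Types (x y z : X) (e : R) (S T : X -> X) (K U : set X).

Lemma nbhs_distP x (P : set X) :
  nbhs x P <-> exists2 r : R, 0 < r & forall y, mdist x y < r -> P y.
Proof.
by rewrite -metricType_numDomainType.filter_from_mdist_nbhs;
  split=> -[r r0 rP]; exists r => // y; exact: rP.
Qed.

Lemma continuous_dist S x e : continuous S -> 0 < e ->
  exists2 r : R, 0 < r & forall y, mdist x y < r -> mdist (S x) (S y) < e.
Proof.
move=> cS e0.
have [_ /(_ _) H] := nbhs_distP x [set y | mdist (S x) (S y) < e].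
by apply/nbhs_distP; apply: (metricType_numDomainType.cvgr_dist_lt (cS x)).
Qed.

Lemma open_dist_lt x e : open [set y | mdist x y < e].
Proof.
rewrite openE => y /= xy; apply/nbhs_distP; exists (e - mdist x y).
  by rewrite subr_gt0.
by move=> z yz /=; have := metric_triangle x y z; lra.
Qed.

Definition displaced S e : set X := [set x | e < mdist (S x) x].

Lemma open_displaced S e : continuous S -> open (displaced S e).
Proof.
move=> cS; rewrite openE => x /= ex; apply/nbhs_distP.
have q0 : 0 < (mdist (S x) x - e) / 2 by rewrite divr_gt0 ?subr_gt0.
have [r r0 Sr] := continuous_dist x cS q0.
exists (Num.min r ((mdist (S x) x - e) / 2)); first by rewrite lt_min r0.
move=> y; rewrite lt_min => /andP[/Sr Sxy xy]; rewrite /displaced/=.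
have := metric_triangle (S x) (S y) x; have := metric_triangle (S y) y x.
rewrite (metric_sym y x); lra.
Qed.

Lemma near_right0 (P : R -> Prop) : (\forall r \near 0^'+, P r) ->
  exists2 r : R, 0 < r & P r.
Proof.
move=> nP; have : \forall r \near (0:R)^'+, 0 < r /\ P r.
  by apply: filterI nP; exact: nbhs_right_gt.
by move=> /filter_ex[r []]; exists r.
Qed.

(** A scale-dependent property that holds around each point of a compact set
    at all small scales holds at a single scale. Lebesgue numbers and uniform
    continuity are both instances. *)
Lemma compact_uniform_radius K (P : R -> X -> Prop) : compact K ->
  (forall x, K x -> exists2 r : R, 0 < r &
     forall y s, mdist x y < r -> s < r -> P s y) ->
  exists2 r : R, 0 < r & forall x, K x -> P r x.
Proof.
move=> /compact_near_coveringP cK H; apply: near_right0.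
apply: cK => x /H[r r0 rP].
exists ([set y | mdist x y < r], [set s | s < r]).
  split; first by apply/nbhs_distP; exists r.
  by apply: nbhs_right_lt.
by case=> y s [/= ? ?]; exact: rP.
Qed.

Lemma lebesgue_number K U : compact K -> open U -> K `<=` U ->
  exists2 r : R, 0 < r & forall x, K x -> forall y, mdist x y < r -> U y.
Proof.
move=> cK oU KU; apply: compact_uniform_radius => // x /KU.
move: oU; rewrite openE => /[apply] /nbhs_distP[r r0 rU].
exists (r / 2); first by rewrite divr_gt0.
move=> y s xy sr z yz; apply: rU.
by have := metric_triangle x y z; lra.
Qed.

Lemma compact_unif_dist S e : compact [set: X] -> continuous S -> 0 < e ->
  exists2 r : R, 0 < r & forall x y, mdist x y < r -> mdist (S x) (S y) < e.
Proof.
move=> cX cS e0; have e2 : 0 < e / 2 by rewrite divr_gt0.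
have [|r r0 Sr] := @compact_uniform_radius [set: X]
  (fun r x => forall y, mdist x y < r -> mdist (S x) (S y) < e) cX.
  move=> x _; have [r r0 Sr] := continuous_dist x cS e2.
  exists (r / 2); first by rewrite divr_gt0.
  move=> y s xy sr z yz.
  have yx : mdist x y < r by lra.
  have zx : mdist x z < r by have := metric_triangle x y z; lra.
  have := metric_triangle (S y) (S x) (S z).
  by rewrite (metric_sym (S y) (S x)); have := Sr _ yx; have := Sr _ zx; lra.
by exists r => // x; exact: Sr.
Qed.

Lemma compact_finite_net K e : compact K -> 0 < e ->
  exists s : seq X, {in s, forall x, K x} /\
    forall x, K x -> exists2 y, y \in s & mdist y x < e.
Proof.
move=> + e0; rewrite compact_cover => cK.
have [||s sK sc] := cK X K (fun y => [set x | mdist y x < e]).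
- by move=> y _; exact: open_dist_lt.
- by move=> x Kx; exists x => //=; rewrite mdistxx.
exists (finmap.enum_fset s); split => [x xs|x /sc[y ys xy]]; last by exists y.
by have := sK x xs; rewrite inE.
Qed.

End Metric.

(** * Borel measures and maps close to the identity *)

Section BorelMeasure.
Context {R : realType} {X : pmetricType R}.
Implicit Types (S T : X -> X) (A B : set (borelType X)) (U K : set X).

Lemma open_borel U : open U -> measurable (U : set (borelType X)).
Proof. by move=> oU; exact: sub_gen_smallest. Qed.

Lemma closed_borel U : closed U -> measurable (U : set (borelType X)).
Proof.
move=> cU; rewrite -(setCK U); apply: measurableC.
by apply: open_borel; exact: closed_openC.
Qed.

Lemma compact_borel K : compact K -> measurable (K : set (borelType X)).
Proof.
move=> cK; apply: closed_borel.
exact: compact_closed (@metric_hausdorff _ X) cK.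
Qed.

Lemma continuous_borel S : continuous S ->
  measurable_fun [set: borelType X] (S : borelType X -> borelType X).
Proof.
move=> /continuousP cS.
apply: (@measurability _ _ (borelType X) (borelType X) setT S (@open X)) => //.
by move=> _ [U oU <-]; rewrite setTI; apply: open_borel; exact: cS.
Qed.

Lemma borel_preimage S B : continuous S -> measurable B ->
  measurable (S @^-1` B : set (borelType X)).
Proof.
by move=> /continuous_borel mS mB; rewrite -[_ @^-1` _]setTI; exact: mS.
Qed.

Lemma continuous_iter T n : continuous T -> continuous (iter n T).
Proof.
move=> cT; elim: n => [|n IH] x; first exact: cvg_id.
exact: (continuous_comp (IH x) (cT _)).
Qed.

Variable mu : probability (borelType X) R.

Lemma invariant_iter T n : continuous T -> invariant_measure mu T ->
  invariant_measure mu (iter n T).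
Proof.
move=> cT iT; elim: n => [//|n IH] B mB.
transitivity (mu (iter n T @^-1` (T @^-1` B))); first by [].
by rewrite IH ?iT//; exact: borel_preimage.
Qed.

Lemma measure_setD_sub A B : measurable A -> measurable B -> A `<=` B ->
  mu (B `\` A) = (mu B - mu A)%E.
Proof.
by move=> mA mB AB; rewrite measureD ?setIidr// ltey_eq fin_num_measure.
Qed.

Hypothesis reg : regular_measure mu.

Lemma regular_sandwich B (e : R) : measurable B -> 0 < e ->
  exists K U, [/\ compact K, open U, K `<=` B & B `<=` U] /\
    (mu (B `\` K) <= e%:E)%E /\ (mu (U `\` B) <= e%:E)%E.
Proof.
move=> mB e0; have [infB supB] := reg mB.
have muB : mu B \is a fin_num by exact: fin_num_measure.
have [_ [U [oU BU] <-] muU] : exists2 x,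
    [set mu U | U in [set U : set X | open U /\ B `<=` U]] x &
    (x < mu B + e%:E)%E.
  by rewrite infB; apply: lb_ereal_inf_adherent; rewrite -?infB.
have [_ [K [cK KB] <-] muK] : exists2 x,
    [set mu K | K in [set K : set X | compact K /\ K `<=` B]] x &
    (mu B - e%:E < x)%E.
  by rewrite supB; apply: ub_ereal_sup_adherent; rewrite -?supB.
exists K, U; split=> //; split.
- have mK := compact_borel cK; rewrite measure_setD_sub//.
  rewrite leeBlDr ?fin_num_measure// addeC.
  by move/ltW: muK; rewrite leeBlDr.
- have mU := open_borel oU; rewrite measure_setD_sub//.
  by rewrite leeBlDr ?fin_num_measure// addeC; exact: ltW.
Qed.

(** Squeeze [B] between a compact [K] and an open [U] of almost the same
    measure. A point of [K] that [S] moves by less than the distance from [K]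
    to the complement of [U] is mapped into [U], hence into [B] unless it is in
    [S^-1 (U \ B)], which by invariance is as small as [U \ B]. *)
Lemma near_identity_set B (eta : R) : measurable B -> 0 < eta ->
  exists2 e : R, 0 < e & forall S, continuous S -> invariant_measure mu S ->
    (mu (displaced S e) <= e%:E)%E -> (mu (B `\` S @^-1` B) <= eta%:E)%E.
Proof.
move=> mB eta0; have e30 : 0 < eta / 3 by rewrite divr_gt0.
have [K [U [[cK oU KB BU] [BK UB]]]] := regular_sandwich mB e30.
have [r r0 rU] := lebesgue_number cK oU (subset_trans KB BU).
exists (Num.min (r / 2) (eta / 3)); first by rewrite lt_min e30 divr_gt0.
move=> S cS iS muS; set e := Num.min _ _ in muS *.
have er : e < r by rewrite gt_min; apply/orP; left; lra.
have ee : e <= eta / 3 by rewrite ge_min lexx orbT.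
have mK := compact_borel cK; have mU := open_borel oU.
have mSUB : measurable (S @^-1` (U `\` B) : set (borelType X)).
  by apply: borel_preimage => //; exact: measurableD.
have mD := open_borel (open_displaced e cS).
have sub : B `\` S @^-1` B `<=`
    (B `\` K) `|` displaced S e `|` S @^-1` (U `\` B).
  move=> x [Bx nSBx]; have [Kx|nKx] := pselect (K x); last by left; left.
  have [xe|] := boolP (e < mdist (S x) x); first by left; right.
  rewrite -leNgt metric_sym => ex; right; split => //.
  by apply: rU Kx _ _; exact: le_lt_trans er.
have mBK : measurable (B `\` K) by exact: measurableD.
apply: (@le_trans _ _ (mu ((B `\` K) `|` displaced S e `|` S @^-1` (U `\` B)))).
  apply: le_measure => //; rewrite inE.
    by apply: measurableD => //; exact: borel_preimage.
  by do 2 apply: measurableU => //.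
apply: le_trans (measureU2 _ _ mSUB) _; first exact: measurableU.
have -> : eta%:E = ((eta / 3)%:E + (eta / 3)%:E + (eta / 3)%:E)%E.
  by rewrite -!EFinD; congr (_%:E); lra.
apply: leeD; last first.
  apply: le_trans UB; rewrite le_eqVlt; apply/orP; left; apply/eqP; apply: iS.
  exact: measurableD.
apply: le_trans (measureU2 _ _ mD) _ => //.
by apply: leeD => //; apply: le_trans muS _; rewrite lee_fin.
Qed.

Lemma invariant_setD_preimage S B :
  continuous S -> invariant_measure mu S -> measurable B ->
  mu (S @^-1` B `\` B) = mu (B `\` S @^-1` B).
Proof.
move=> cS iS mB; have mSB := borel_preimage cS mB.
transitivity (mu B - mu (B `&` S @^-1` B))%E.
  rewrite measureD// ?ltey_eq ?fin_num_measure// setIC.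
  by congr (_ - _)%E; exact: iS.
by rewrite measureD// ltey_eq fin_num_measure.
Qed.

End BorelMeasure.

(** * The L^2 norm *)

Lemma cvge0_nearP (R : realType) (u : nat -> \bar R) : (forall k, 0 <= u k)%E ->
  u k @[k --> \oo] --> 0%E <->
  forall eta : R, 0 < eta -> \forall k \near \oo, (u k <= eta%:E)%E.
Proof.
move=> u0; split=> [cu eta eta0|H].
  have cu' : \forall k \near \oo, (u k < eta%:E)%E.
    exact: cu _ (nbhs_open_ereal_lt (f := fun=> eta) eta0).
  by apply: filterS cu' => k /ltW.
apply/fine_cvgP; split.
  near=> k; rewrite ge0_fin_numE//.
  apply: (@le_lt_trans _ _ 1%E); last exact: ltry.
  by near: k; exact: H.
apply/cvgr0Pnorm_le => eta eta0; near=> k => /=.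
have : (u k <= eta%:E)%E by near: k; exact: H.
have := u0 k; case: (u k) => [r|//|//] /=; rewrite !lee_fin => r0 re.
by rewrite ger0_norm.
Unshelve. all: by end_near. Qed.

Section Lnorm2.
Context d (T : measurableType d) (R : realType).
Variable mu : {measure set T -> \bar R}.
Implicit Types (f g h : T -> R).

Lemma Lnorm2_sqr_integral h :
  ('N[mu]_2%:E[EFin \o h] `^ 2 = \int[mu]_x (h x ^+ 2)%:E)%E.
Proof.
rewrite poweR_Lnorm//; apply: eq_integral => x _ /=.
by rewrite powR_mulrn ?normr_ge0// real_normK// num_real.
Qed.

Lemma Lnorm2_le h (eta : R) : 0 <= eta ->
  ('N[mu]_2%:E[EFin \o h] <= eta%:E)%E <->
  (\int[mu]_x (h x ^+ 2)%:E <= (eta ^+ 2)%:E)%E.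
Proof.
move=> eta0; rewrite -Lnorm2_sqr_integral.
have := Lnorm_ge0 mu 2%:E (EFin \o h); case: ('N[mu]_2%:E[_])%E => [r|_|//].
  rewrite lee_fin => r0; rewrite poweR_EFin powR_mulrn// !lee_fin.
  by rewrite ler_sqr.
by rewrite poweRyr// !leye_eq.
Qed.

Lemma Lnorm2_opp h :
  ('N[mu]_2%:E[EFin \o (\- h)%R] = 'N[mu]_2%:E[EFin \o h])%E.
Proof. by rewrite -[RHS]oppe_Lnorm; exact: eq_Lnorm. Qed.

Lemma Lnorm2_preserving (S : T -> T) h :
  measurable_fun setT S -> (forall A, measurable A -> mu (S @^-1` A) = mu A) ->
  measurable_fun setT h ->
  ('N[mu]_2%:E[EFin \o (h \o S)] = 'N[mu]_2%:E[EFin \o h])%E.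
Proof.
move=> mS iS mh; rewrite unlock; congr (_ `^ _)%E.
have := @ge0_integral_pushforward _ _ _ _ _ S mS mu setT
  (fun x => (`|(EFin \o h) x| `^ 2)%E).
rewrite preimage_setT => <-//.
- by apply: eq_measure_integral => A mA _; exact: iS.
- apply: (measurableT_comp (measurable_poweR _)).
  by apply: measurableT_comp => //; exact/measurable_EFinP.
- by move=> x _; exact: poweR_ge0.
Qed.

Import HBNNSimple.

(** Simple functions increasing to [f] converge to it in [L^2] by dominated
    convergence, with dominating function [f ^+ 2]. *)
Lemma nnsfun_dense_L2 f (eta : R) :
  measurable_fun setT f -> (forall x, 0 <= f x) ->
  mu.-integrable setT (fun x => (f x ^+ 2)%:E) -> 0 < eta ->
  exists g : {nnsfun T >-> R},
    ('N[mu]_2%:E[EFin \o (f \- g)%R] <= eta%:E)%E.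
Proof.
move=> mf f0 intf eta0.
have mF : measurable_fun setT (EFin \o f) by exact/measurable_EFinP.
have F0 x : [set: T] x -> (0 <= (EFin \o f) x)%E by rewrite /= lee_fin.
pose g_ n := nnsfun_approx measurableT mF n.
have cvg_g x : g_ n x @[n --> \oo] --> f x.
  by have := cvg_nnsfun_approx measurableT mF F0 (x := x) I => /fine_cvgP[].
have g_le n x : g_ n x <= f x.
  by rewrite -lee_fin /g_ nnsfun_approxE; exact: (le_approx n F0).
have mfg n : measurable_fun setT (f \- g_ n)%R by exact: measurable_funB.
have : (\int[mu]_x ((f x - g_ n x) ^+ 2)%:E @[n --> \oo] -->
        \int[mu]_x (cst 0%E x))%E.
  apply: (dominated_cvg measurableT _ _ _ intf) => //.
  - by move=> n; apply/measurable_EFinP; exact: (measurable_funX 2%N (mfg n)).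
  - move=> x _; apply: cvg_EFin; first by near=> n.
    have : (f x - g_ n x) ^+ 2 @[n --> \oo] --> (f x - f x) ^+ 2.
      apply: (cvg_comp (fun n => f x - g_ n x) (fun y => y ^+ 2)).
        by apply: cvgB => //; exact: cvg_cst.
      exact: exprn_continuous.
    by rewrite subrr expr0n.
  - move=> n x _; rewrite gee0_abs ?lee_fin ?sqr_ge0//.
    rewrite ler_sqr ?nnegrE ?subr_ge0//.
    by rewrite gerBl.
have eta20 : 0 < eta ^+ 2 by rewrite exprn_gt0.
have nb := nbhs_open_ereal_lt (f := fun=> eta ^+ 2) eta20.
rewrite integral0 => /(_ _ nb)[N _ HN].
exists (g_ N); apply/Lnorm2_le; first exact: ltW.
by apply/ltW; exact: HN N (leqnn N).
Unshelve. all: by end_near. Qed.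
End Lnorm2.

(** * Square-integrable functions under maps close to the identity *)

Section Continuity.
Context {R : realType} {X : pmetricType R} (mu : probability (borelType X) R).
Implicit Types (S : X -> X) (f g : borelType X -> R) (B : set (borelType X)).
Hypothesis reg : regular_measure mu.

(** Continuity at the identity of [S |-> f \o S], from the measure-preserving
    continuous maps with convergence in measure to [L^2]. Quantifying over all
    [S] rather than over the iterates along a sequence makes the property
    independent of the return times. *)
Definition asymptotically_fixed f : Prop :=
  measurable_fun setT f /\
  forall eta : R, 0 < eta -> exists2 e : R, 0 < e &
    forall S, continuous S -> invariant_measure mu S ->
      (mu (displaced S e) <= e%:E)%E ->
      ('N[mu]_2%:E[EFin \o (f \o S \- f)%R] <= eta%:E)%E.

Lemma measure_displacedS S (e e' : R) : continuous S -> e <= e' ->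
  (mu (displaced S e) <= e%:E)%E -> (mu (displaced S e') <= e'%:E)%E.
Proof.
move=> cS ee' muS; apply: (@le_trans _ _ e%:E); last by rewrite lee_fin.
have mD r := open_borel (open_displaced r cS).
apply: le_trans muS; apply: le_measure; rewrite ?inE//.
by move=> x; exact: le_lt_trans.
Qed.

Lemma asymptotically_fixed_opp f :
  asymptotically_fixed f -> asymptotically_fixed (\- f).
Proof.
move=> [mf Hf]; split; first exact: measurable_funN.
move=> eta /Hf[e e0 He]; exists e => // S cS iS /(He S cS iS).
rewrite -Lnorm2_opp; congr (_ <= _)%E; apply: eq_Lnorm => x /=.
by rewrite opprD.
Qed.

Lemma asymptotically_fixed_add f g :
  asymptotically_fixed f -> asymptotically_fixed g ->
  asymptotically_fixed (f \+ g).
Proof.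
move=> [mf Hf] [mg Hg]; split; first exact: measurable_funD.
move=> eta eta0; have eta20 : 0 < eta / 2 by rewrite divr_gt0.
have [e e0 He] := Hf _ eta20; have [e' e'0 He'] := Hg _ eta20.
exists (Num.min e e'); first by rewrite lt_min e0.
move=> S cS iS muS; have mS := continuous_borel cS.
have le_e : Num.min e e' <= e by rewrite ge_min lexx.
have le_e' : Num.min e e' <= e' by rewrite ge_min lexx orbT.
have /(He S cS iS) nf := measure_displacedS cS le_e muS.
have /(He' S cS iS) ng := measure_displacedS cS le_e' muS.
have -> : (f \+ g) \o S \- (f \+ g) = (f \o S \- f) \+ (g \o S \- g).
  by apply/funext => x /=; rewrite opprD addrACA.
have mfS (h : borelType X -> R) : measurable_fun setT h ->
    measurable_fun setT (h \o (S : borelType X -> borelType X) \- h).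
  by move=> mh; apply: measurable_funB => //; exact: measurableT_comp.
apply: le_trans (eminkowski mu (mfS _ mf) (mfS _ mg) _) _.
  by rewrite lee1n.
by rewrite (splitr eta) EFinD; exact: (leeD nf ng).
Qed.

(** The decomposition [f S - f = (f - g) S + (g S - g) - (f - g)], whose outer
    terms have the same norm because [S] preserves [mu]. *)
Lemma asymptotically_fixed_lim f : measurable_fun setT f ->
  (forall eta : R, 0 < eta -> exists2 g, asymptotically_fixed g &
     ('N[mu]_2%:E[EFin \o (f \- g)%R] <= eta%:E)%E) ->
  asymptotically_fixed f.
Proof.
move=> mf H; split=> // eta eta0; have eta30 : 0 < eta / 3 by rewrite divr_gt0.
have [g [mg Hg] fg] := H _ eta30.
have [e e0 He] := Hg _ eta30; exists e => // S cS iS muS.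
have mS := continuous_borel cS.
have mfg : measurable_fun setT (f \- g) by exact: measurable_funB.
have mgS : measurable_fun setT (g \o (S : borelType X -> borelType X) \- g).
  by apply: measurable_funB => //; exact: measurableT_comp.
have mfgS : measurable_fun setT
    ((f \- g) \o (S : borelType X -> borelType X)).
  exact: measurableT_comp.
have -> : f \o S \- f = ((f \- g) \o S \+ (g \o S \- g)) \+ (\- (f \- g)).
  by apply/funext => x /=; lra.
apply: le_trans (eminkowski mu _ _ _) _ => //.
- exact: measurable_funD.
- exact: measurable_funN.
- by rewrite lee1n.
have -> : eta%:E = ((eta / 3)%:E + (eta / 3)%:E + (eta / 3)%:E)%E.
  by rewrite -!EFinD; congr (_%:E); lra.
apply: leeD; last by rewrite Lnorm2_opp.
apply: le_trans (eminkowski mu mfgS mgS _) _; first by rewrite lee1n.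
apply: leeD; last exact: He.
by rewrite Lnorm2_preserving.
Qed.

(** The square of [c * \1_B \o S - c * \1_B] is [c ^+ 2] times the indicator of
    the symmetric difference of [B] and [S^-1 B]. *)
Lemma asymptotically_fixed_scaled_indic B (c : R) : measurable B ->
  asymptotically_fixed (fun x => c * \1_B x).
Proof.
move=> mB; split.
  by apply: measurable_funM => //; exact: measurable_indic.
(* The factor 2 accounts for the two halves of the symmetric difference, and
   adding 1 keeps the denominator positive when c = 0. *)
move=> eta eta0; pose k := 2 * (c ^+ 2 + 1).
have k0 : 0 < k by rewrite mulr_gt0// ltr_wpDl// sqr_ge0.
have [e e0 He] := near_identity_set reg mB (divr_gt0 (exprn_gt0 2 eta0) k0).
exists e => // S cS iS /(He S cS iS) muBS; apply/Lnorm2_le; first exact: ltW.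
have mSB := borel_preimage cS mB.
pose D : set (borelType X) := (S @^-1` B `\` B) `|` (B `\` S @^-1` B).
have mD : measurable D by apply: measurableU; exact: measurableD.
have muSB : (mu (S @^-1` B `\` B) <= (eta ^+ 2 / k)%:E)%E.
  by rewrite invariant_setD_preimage.
have muD : (mu D <= (eta ^+ 2 / k + eta ^+ 2 / k)%:E)%E.
  apply: le_trans (measureU2 _ _ _) _; try exact: measurableD.
  by rewrite EFinD; exact: leeD.
rewrite (_ : (\int[mu]_x _)%E =
  (\int[mu]_x ((c ^+ 2)%:E * (\1_D x)%:E))%E); last first.
  apply: eq_integral => x _ /=; rewrite -EFinM; congr (_%:E).
  rewrite -mulrBr exprMn; congr (_ * _); rewrite !indicE.
  rewrite /D in_setU !in_setD -[S x \in B]/(x \in S @^-1` B).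
  case: (x \in S @^-1` B); case: (x \in B) => /=;
    by rewrite ?subrr ?subr0 ?sub0r ?sqrrN ?expr1n ?expr0n.
rewrite ge0_integralZl//; last 2 first.
- by apply/measurable_EFinP; exact: measurable_indic.
- by rewrite lee_fin sqr_ge0.
rewrite integral_indic// setIT.
apply: le_trans (lee_wpmul2l _ muD) _; first by rewrite lee_fin sqr_ge0.
rewrite -EFinM lee_fin.
have q0 : 0 < c ^+ 2 + 1 by rewrite ltr_wpDl// sqr_ge0.
have -> : c ^+ 2 * (eta ^+ 2 / k + eta ^+ 2 / k) =
    eta ^+ 2 * (c ^+ 2 / (c ^+ 2 + 1)).
  by rewrite /k; field; rewrite gt_eqF.
rewrite ger_pMr ?exprn_gt0// ler_pdivrMr// mul1r lerDl; exact: ler01.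
Qed.

End Continuity.

Section L2.
Context {R : realType} {X : pmetricType R} (mu : probability (borelType X) R).
Implicit Types (S T : X -> X) (f g : borelType X -> R) (B : set (borelType X)).
Hypothesis reg : regular_measure mu.
Import HBNNSimple.

Lemma asymptotically_fixed_simple (g : {nnsfun borelType X >-> R}) :
  asymptotically_fixed mu g.
Proof.
have -> : (g : borelType X -> R) =
    \sum_(y <- finmap.enum_fset (fset_set (range g)))
       (fun x => y * \1_(g @^-1` [set y]) x).
  apply/funext => x; rewrite fct_sumE [LHS]fimfunE.
  exact: fsbig_finite.
apply: (big_ind (asymptotically_fixed mu)) => [|f h|y _].
- have := @asymptotically_fixed_scaled_indic _ _ mu reg set0 0 measurable0.
  by congr asymptotically_fixed; apply/funext => x; rewrite mul0r.
- exact: asymptotically_fixed_add.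
- exact: asymptotically_fixed_scaled_indic.
Qed.

Lemma asymptotically_fixed_nonneg_L2 f :
  measurable_fun setT f -> (forall x, 0 <= f x) ->
  mu.-integrable setT (fun x => (f x ^+ 2)%:E) -> asymptotically_fixed mu f.
Proof.
move=> mf f0 intf; apply: asymptotically_fixed_lim => // eta eta0.
have [g fg] := nnsfun_dense_L2 mf f0 intf eta0.
by exists g => //; exact: asymptotically_fixed_simple.
Qed.

Lemma asymptotically_fixed_L2 f :
  f \in Lfun mu 2%:E -> asymptotically_fixed mu f.
Proof.
move=> fL; have mf : measurable_fun setT f.
  by move: fL; rewrite inE => /andP[/[!inE]].
have part (h : borelType X -> R) : measurable_fun setT h ->
    (forall x, 0 <= h x <= `|f x|) -> asymptotically_fixed mu h.
  move=> mh hf; apply: asymptotically_fixed_nonneg_L2 => // [x|].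
    by have /andP[] := hf x.
  apply: (le_integrable measurableT) (Lfun2_integrable_sqr fL).
    by apply/measurable_EFinP; exact: measurable_funX.
  move=> x _ /=; rewrite lee_fin !normrX lerXn2r ?nnegrE//.
  by have /andP[h0 hle] := hf x; rewrite ger0_norm.
rewrite -(funrposBneg f).
apply: asymptotically_fixed_add; last apply: asymptotically_fixed_opp.
  apply: part => [|x]; first exact: measurable_funrpos.
  by rewrite funrpos_ge0 /funrpos ge_max normr_ge0 ler_norm.
apply: part => [|x]; first exact: measurable_funrneg.
by rewrite funrneg_ge0 /funrneg ge_max normr_ge0 -normrN ler_norm.
Qed.

(** * Recurrence in measure *)
Definition recurrent_in_measure T : Prop := forall (e : R) (N : nat), 0 < e ->
  exists2 n, (N <= n)%N & (mu (displaced (iter n T) e) <= e%:E)%E.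

Lemma recurrent_rigid T : continuous T -> invariant_measure mu T ->
  recurrent_in_measure T -> rigid mu T.
Proof.
move=> cT iT recT.
have /choice[t ht] : forall kN : nat * nat, exists n, (kN.2 <= n)%N /\
    (mu (displaced (iter n T) (kN.1.+1%:R^-1)) <= (kN.1.+1%:R^-1)%:E)%E.
  move=> [k N]; have [|n Nn muT] := recT (k.+1%:R^-1) N; last by exists n.
  by rewrite invr_gt0.
(* Each return time is sought beyond the previous one, which makes the sequence
   strictly increasing. *)
pose u := fix u k := if k is j.+1 then t (k, (u j).+1) else t (0%N, 0%N).
have uS k : (u k < u k.+1)%N by have [] := ht (k.+1, (u k).+1).
have hu k : (mu (displaced (iter (u k) T) (k.+1%:R^-1)) <= (k.+1%:R^-1)%:E)%E.
  by case: k => [|k]; [have [] := ht (0%N, 0%N)|have [] := ht (k.+1, (u k).+1)].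
exists u; split; first exact/increasing_seqP.
move=> f /asymptotically_fixed_L2[_ Hf].
apply/cvge0_nearP => [k|eta eta0]; first exact: Lnorm_ge0.
have [e e0 He] := Hf _ eta0.
near=> k; apply: He.
- exact: continuous_iter.
- exact: invariant_iter.
- apply: measure_displacedS (hu k); first exact: continuous_iter.
  by apply/ltW; near: k; exact: (near_infty_natSinv_lt (PosNum e0)).
Unshelve. all: by end_near. Qed.

End L2.

Lemma subsequence_ge (a : nat -> nat) m n : subsequence a -> (m <= n)%N ->
  (n - m <= a n - a m)%N.
Proof.
move=> sa; have aS n' : (a n' < a n'.+1)%N.
  by have /increasing_seqP := sa; apply.
elim: n => [|n IH]; first by case: m.
rewrite leq_eqVlt => /predU1P[->|]; first by rewrite !subnn.
rewrite ltnS => mn; have := IH mn; have := aS n.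
have : (a m <= a n)%N by have := sa m n; rewrite !leEnat mn.
lia.
Qed.

Lemma finite_collision (C : finType) (c : nat -> C) :
  exists i j, (i < j)%N /\ c i = c j.
Proof.
have /injectivePn[i [j ij cij]] : ~~ injectiveb (fun i : 'I_#|C|.+1 => c i).
  by apply/negP => /injectiveP/leq_card; rewrite card_ord ltnn.
have [lt|lt|/val_inj eq] := ltngtP i j; last by rewrite eq eqxx in ij.
  by exists i, j.
by exists j, i.
Qed.

Section Recurrence.
Context {R : realType} {X : pmetricType R} (mu : probability (borelType X) R).
Variable T : X -> X.
Hypotheses (cX : compact [set: X]) (cT : continuous T).
Hypothesis iT : invariant_measure mu T.

(** Record, for each index, which point of a finite net of [X] is close to the
    image of each point of a finite net of [K]. Only finitely many records are
    possible, so two of the indices [0], [N], [2 N], ... share theirs; by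
    equicontinuity agreement on the net of [K] extends to all of [K]. *)
Lemma equicontinuous_collision K (a : nat -> nat) (e : R) (N : nat) :
  compact K -> subsequence a -> equicontinuous_along T a K -> 0 < e ->
  exists m n, [/\ (m <= n)%N, (N <= n - m)%N &
    forall x, K x -> mdist (iter n T x) (iter m T x) < e].
Proof.
move=> cK sa eqK e0; have e40 : 0 < e / 4 by rewrite divr_gt0.
have [d d0 Hd] := eqK _ e40.
have [s [sK sd]] := compact_finite_net cK d0.
have [s' [_ sd']] := compact_finite_net cX e40.
have /choice[c hc] : forall nx : nat * seq_sub s, exists y : seq_sub s',
    mdist (val y) (iter (a nx.1) T (val nx.2)) < e / 4.
  move=> [n x]; have [y ys yx] := sd' (iter (a n) T (val x)) I.
  by exists (SeqSub ys).
have [i [j [ij /ffunP cij]]] :=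
  finite_collision (fun n => [ffun x => c ((N * n)%N, x)]).
have Nij : (N * i <= N * j)%N by rewrite leq_mul2l ltnW ?orbT.
exists (a (N * i)%N), (a (N * j)%N); split.
- by have := sa (N * i)%N (N * j)%N; rewrite !leEnat Nij.
- apply: leq_trans (subsequence_ge sa Nij).
  by rewrite -mulnBr leq_pmulr// subn_gt0.
move=> x Kx; have [y ys yx] := sd x Kx; have Ky := sK y ys.
have := cij (SeqSub ys); rewrite !ffunE => ceq.
have := hc ((N * i)%N, SeqSub ys); have := hc ((N * j)%N, SeqSub ys).
rewrite ceq /=.
set z := ssval _ => zj zi.
have xi := Hd _ _ Ky Kx yx (N * i)%N; have xj := Hd _ _ Ky Kx yx (N * j)%N.
set Tix := iter _ T x in xj *; set Tjx := iter _ T x in xi *.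
set Tiy := iter _ T y in zj xj *; set Tjy := iter _ T y in zi xi *.
have := metric_triangle Tix Tiy Tjx; have := metric_triangle Tiy z Tjx.
have := metric_triangle z Tjy Tjx.
by rewrite (metric_sym Tix Tiy) (metric_sym Tiy z); lra.
Qed.

Lemma equicontinuous_recurrent (a : nat -> nat) : subsequence a ->
  measure_equicontinuous_along mu T a -> recurrent_in_measure mu T.
Proof.
move=> sa Ha e N e0; have [K [cK eK muK]] := Ha e e0.
have [m [n [mn Nnm Hnm]]] := equicontinuous_collision N cK sa eK e0.
exists (n - m)%N => //; have mK := compact_borel cK.
have oD := open_displaced e (continuous_iter (n := (n - m)%N) cT).
have mD := open_borel oD.
(* By invariance the displaced set may be pulled back by [T^m], and
   [T^(n - m) (T^m x) = T^n x]. *)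
have <- := invariant_iter (mu := mu) m cT iT mD.
apply: (@le_trans _ _ (mu (~` K))).
  apply: le_measure; rewrite ?inE.
  - exact: borel_preimage (continuous_iter cT) mD.
  - exact: measurableC.
  move=> x; rewrite /= /displaced/= -iterD subnK// => ltx Kx.
  by have := Hnm _ Kx; rewrite ltNge (ltW ltx).
rewrite probability_setC// leeBlDr ?fin_num_measure// -leeBlDl//.
exact: ltW.
Qed.

Lemma rigid_recurrent : rigid mu T -> recurrent_in_measure mu T.
Proof.
move=> [t [st Ht]] e N e0; have e20 : 0 < e / 2 by rewrite divr_gt0.
have [s [_ sc]] := compact_finite_net cX e20.
pose B (y : X) : set (borelType X) := [set x | mdist y x < e / 2].
have mB y : measurable (B y) by apply: open_borel; exact: open_dist_lt.
pose n := size s.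
pose A k i := B (nth point s i) `\` iter (t k) T @^-1` B (nth point s i).
have mA k i : measurable (A k i : set (borelType X)).
  apply: measurableD => //; apply: borel_preimage => //.
  exact: continuous_iter.
(* Dividing by the successor of [n] also covers an empty net. *)
have eta0 : 0 < e / n.+1%:R by rewrite divr_gt0.
have small i : \forall k \near \oo, (mu (A k i) <= (e / n.+1%:R)%:E)%E.
  set y := nth point s i.
  have L : (\1_(B y) : borelType X -> R) \in Lfun mu 2%:E.
    rewrite inE; apply/andP; split; rewrite inE/=.
      exact: measurable_indic.
    apply: le_lt_trans (ltry 1); apply/Lnorm2_le => //; rewrite expr1n.
    rewrite (eq_integral (EFin \o \1_(B y))) => [|x _]; last first.
      by rewrite /= indicE; case: (_ \in _); rewrite ?expr1n ?expr0n.
    by rewrite integral_indic// setIT probability_le1.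
  have := Ht _ L; move/cvge0_nearP => /(_ (fun k => Lnorm_ge0 _ _ _)).
  have r0 : 0 < Num.sqrt (e / n.+1%:R) by rewrite sqrtr_gt0.
  move=> /(_ _ r0); apply: filterS => k.
  move/Lnorm2_le => /(_ (ltW r0)); rewrite (sqr_sqrtr (ltW eta0)) => intle.
  apply: le_trans intle.
  have mBS : measurable_fun [set: borelType X]
      ((\1_(B y) : borelType X -> R) \o
       (iter (t k) T : borelType X -> borelType X)).
    apply: measurableT_comp; first exact: measurable_indic.
    exact: continuous_borel (continuous_iter cT).
  have := integral_indic mu measurableT (mA k i); rewrite setIT => <-.
  apply: ge0_le_integral => //.
  - exact/measurable_EFinP/measurable_indic.
  - apply/measurable_EFinP; apply: (measurable_funX 2%N).
    exact: measurable_funB.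
  - move=> x _; rewrite lee_fin /= [leLHS]indicE.
    case: (boolP (x \in A k i)) => [|_]; last exact: sqr_ge0.
    rewrite inE => -[Bx nBTx]; rewrite !indicE /=.
    have -> : (iter (t k) T x \in B y) = false by exact: memNset.
    by rewrite (mem_set Bx) sub0r sqrrN expr1n.
have allsmall : \forall k \near \oo, forall i : 'I_n,
    (mu (A k i) <= (e / n.+1%:R)%:E)%E.
  apply: (@filter_forall _ _ (fun i : 'I_n => [set k | _])) => i.
  exact: small.
have late : \forall k \near \oo, (N <= t k)%N.
  exists N => // k /= Nk; apply: leq_trans Nk _.
  by have := subsequence_ge st (leq0n k); lia.
have [k [Nk Ak]] := filter_ex (filterI late allsmall); exists (t k) => //.
have sub : displaced (iter (t k) T) e `<=` \big[setU/set0]_(i < n) A k i.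
  move=> x xe; have [y ys yx] := sc x I; rewrite -bigcup_mkord.
  exists (index y s); rewrite /= ?index_mem// /A nth_index//; split => //= yTx.
  have := metric_triangle (iter (t k) T x) y x.
  by rewrite (metric_sym _ y); move: xe yTx; rewrite /displaced/= /B/=; lra.
apply: (@le_trans _ _ (mu (\big[setU/set0]_(i < n) A k i))).
  apply: le_measure; rewrite ?inE//.
    by apply: open_borel; apply: open_displaced; exact: continuous_iter.
  by apply: bigsetU_measurable.
apply: le_trans (Boole_inequality mu (fun i _ => mA k i)) _.
apply: le_trans (lee_sum _ (fun i _ => Ak i)) _.
rewrite sumEFin lee_fin sumr_const card_ord -[_ *+ n]mulr_natr -mulrA ger_pMr//.
by rewrite mulrC ler_pdivrMr// mul1r ler_nat.
Qed.

End Recurrence.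

(** * Finite sums and IP-sets *)

Lemma unbounded_enumeration (A : set nat) :
  (forall n, exists2 m, A m & (n <= m)%N) ->
  exists a : nat -> nat, subsequence a /\ range a = A.
Proof.
move=> Ainf.
have /choice[next hnext] : forall n, exists m, [/\ A m, (n <= m)%N &
    forall p, A p -> (n <= p)%N -> (m <= p)%N].
  move=> n; have Aex : exists m, `[< A m >] && (n <= m)%N.
    by have [m Am nm] := Ainf n; exists m; rewrite nm andbT; exact/asboolP.
  case: (ex_minnP Aex) => m /andP[/asboolP Am nm] min_m.
  exists m; split=> // p Ap np.
  by apply: min_m; rewrite np andbT; exact/asboolP.
pose a := fix a k := if k is j.+1 then next (a j).+1 else next 0%N.
have aS k : (a k < a k.+1)%N by have [] := hnext (a k).+1.
have a_ge k : (k <= a k)%N by elim: k => // k IH; exact: leq_ltn_trans (aS k).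
exists a; split; first exact/increasing_seqP.
(* An element [m] of [A] is [a k] for the least [k] with [m <= a k]. *)
apply/seteqP; split=> [_ [k _ <-]|m Am].
  by case: k => [|k]; [have [] := hnext 0%N|have [] := hnext (a k).+1].
have ex_k : exists k, (m <= a k)%N by exists m.
case: (ex_minnP ex_k) => k mk min_k; exists k => //; apply/eqP.
rewrite eqn_leq mk andbT; case: k mk min_k => [|k] _ min_k.
  by have [_ _] := hnext 0%N; apply.
have [_ _] := hnext (a k).+1; apply=> //.
by rewrite ltnNge; apply/negP => /min_k; rewrite ltnn.
Qed.

Lemma FS_unbounded (b : nat -> nat) : (forall i, (0 < b i)%N) ->
  forall n, exists2 m, FS b m & (n <= m)%N.
Proof.
move=> b0 n; exists (\sum_(i <- iota 0 n.+1) b i)%N.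
  by exists (iota 0 n.+1) => //; split=> //; exact: iota_ltn_sorted.
apply: (@leq_trans (\sum_(i <- iota 0 n.+1) 1)%N); last exact: leq_sum.
by rewrite sum1_size size_iota.
Qed.

(** An element of [FS b] is given by a list [s] of indices; cutting [s] at [n]
    allows to add its terms one at a time by increasing index. *)
Definition partial_sum (b : nat -> nat) (s : seq nat) n :=
  (\sum_(0 <= i < n | i \in s) b i)%N.

Lemma partial_sum_all b s n : uniq s -> all (fun i => i < n)%N s ->
  partial_sum b s n = (\sum_(i <- s) b i)%N.
Proof.
move=> us sn; rewrite /partial_sum -big_filter; apply: perm_big.
apply: uniq_perm => // [|i]; first exact/filter_uniq/iota_uniq.
rewrite mem_filter mem_index_iota /=.
by case: (boolP (i \in s)) => //= /(allP sn).
Qed.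

Lemma partial_sum_le b s n : (partial_sum b s n <= \sum_(0 <= i < n) b i)%N.
Proof.
rewrite /partial_sum big_mkcond; apply: leq_sum => i _.
by case: ifP.
Qed.

Lemma partial_sumS b s n : partial_sum b s n.+1 =
  (partial_sum b s n + if n \in s then b n else 0)%N.
Proof.
by rewrite /partial_sum [LHS]big_mkcond (big_nat_recr n 0)//= -big_mkcond.
Qed.

Section IP.
Context {R : realType} {X : pmetricType R} (mu : probability (borelType X) R).
Variable T : X -> X.
Hypotheses (cX : compact [set: X]) (cT : continuous T).

Lemma iter_unif_dist (N : nat) (e : R) : 0 < e -> exists2 r : R, 0 < r &
  forall j, (j <= N)%N -> forall x y, mdist x y < r ->
    mdist (iter j T x) (iter j T y) < e.
Proof.
move=> e0; elim: N => [|N [r r0 Hr]].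
  by exists e => // j; rewrite leqn0 => /eqP->.
have [r' r'0 Hr'] := compact_unif_dist cX (continuous_iter (n := N.+1) cT) e0.
exists (Num.min r r') => [|j]; first by rewrite lt_min r0.
rewrite leq_eqVlt => /predU1P[->|jN] x y; rewrite lt_min => /andP[xr xr'].
  exact: Hr'.
exact: Hr.
Qed.

Local Notation w := (GRing.exp (2^-1 : R)).

(** Adding the terms of index [N], ..., [M - 1] one by one moves the iterate by
    at most [2^-N + ... + 2^-(M-1)]. The hypothesis on [x] is applied with [j]
    the sum of the terms already added. *)
Lemma IP_tail (b : nat -> nat) (s : seq nat) (x : X) (N M : nat) :
  (forall k j, (N <= k)%N -> (j <= \sum_(0 <= i < k) b i)%N ->
     mdist (iter (j + b k) T x) (iter j T x) <= w k) ->
  (N <= M)%N ->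
  mdist (iter (partial_sum b s M) T x) (iter (partial_sum b s N) T x) <=
    2 * w N - 2 * w M.
Proof.
move=> H; elim: M => [|M IH].
  by rewrite leqn0 => /eqP->; rewrite mdistxx subrr.
rewrite leq_eqVlt => /predU1P[->|]; first by rewrite mdistxx subrr.
rewrite ltnS => NM; have {IH} IH := IH NM.
have wS : w M = 2 * w M.+1 by rewrite exprS mulrA divff ?mul1r.
have w0 : 0 <= w M.+1 by rewrite exprn_ge0.
rewrite partial_sumS; case: ifP => _; last by rewrite addn0; lra.
have := H M _ NM (partial_sum_le b s M).
have := metric_triangle (iter (partial_sum b s M + b M) T x)
  (iter (partial_sum b s M) T x) (iter (partial_sum b s N) T x).
lra.
Qed.

(** [D k] consists of the points that [T^(b k)] moves by more than a threshold
    which is at most [2^-k] and is chosen after [b 0], ..., [b (k-1)], by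
    uniform continuity of the finitely many [T^j] concerned. *)
Lemma fast_returns : recurrent_in_measure mu T ->
  exists (b : nat -> nat) (D : nat -> set (borelType X)),
    [/\ forall k, (0 < b k)%N, forall k, open (D k : set X),
        forall k, (mu (D k) <= (w k)%:E)%E &
        forall k x j, ~ D k x -> (j <= \sum_(0 <= i < k) b i)%N ->
          mdist (iter (j + b k) T x) (iter j T x) <= w k].
Proof.
move=> recT.
have w0 k : 0 < w k by rewrite exprn_gt0.
have /choice[c hc] : forall kN : nat * nat, exists er : R * nat,
  [/\ er.1 <= w kN.1, (0 < er.2)%N,
     (mu (displaced (iter er.2 T) er.1) <= er.1%:E)%E &
     forall j x y, (j <= kN.2)%N -> mdist x y <= er.1 ->
       mdist (iter j T x) (iter j T y) <= w kN.1].
  move=> [k N] /=; have [r r0 Hr] := iter_unif_dist N (w0 k).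
  pose e := Num.min (r / 2) (w k).
  have e0 : 0 < e by rewrite lt_min divr_gt0 ?w0.
  have er : e < r by rewrite gt_min; apply/orP; left; lra.
  have [n n0 mun] := recT e 1%N e0.
  exists (e, n); split=> //=; first by rewrite ge_min lexx orbT.
  move=> j x y jN xy; apply/ltW/Hr => //; exact: le_lt_trans er.
(* The choice at step [k] depends on the past only through the sum of the
   generators found so far, so the recursion runs on that sum. *)
pose sigma := fix sigma k :=
  if k is j.+1 then (sigma j + (c (j, sigma j)).2)%N else 0%N.
pose b k := (c (k, sigma k)).2; pose e k := (c (k, sigma k)).1.
have sigmaE k : (\sum_(0 <= i < k) b i)%N = sigma k.
  elim: k => [|k IH]; first by rewrite big_geq.
  by rewrite (big_nat_recr k 0)//= IH.
exists b, (fun k => displaced (iter (b k) T) (e k)); split=> k.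
- by have [] := hc (k, sigma k).
- exact/open_displaced/continuous_iter.
- have [ew _ muD _] := hc (k, sigma k).
  by apply: le_trans muD _; rewrite lee_fin.
move=> x j /negP; rewrite -leNgt sigmaE => xe js.
by rewrite iterD; have [_ _ _] := hc (k, sigma k); apply.
Qed.

Lemma pow2_small (e : R) : 0 < e -> \forall k \near \oo, 2 * w k < e.
Proof.
move=> e0; have : (2 * w k @[k --> \oo] --> (2 * 0 : R)).
  by apply: cvgMr; apply: cvg_expr; rewrite ger0_norm// invf_lt1 ?ltr1n.
rewrite mulr0 => /cvgr0Pnorm_lt/(_ _ e0).
by apply: filterS => k; apply: le_lt_trans; rewrite ler_norm.
Qed.

(** The compact set is the complement of the union of the [D k] with [k >= N],
    which has measure at most [2 * 2^-N]. *)
Lemma recurrent_IP : recurrent_in_measure mu T ->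
  exists a : nat -> nat, [/\ subsequence a, IP_set (range a) &
    measure_equicontinuous_along mu T a].
Proof.
move=> /fast_returns[b [D [b0 oD muD HD]]].
have [a [sa aE]] := unbounded_enumeration (FS_unbounded b0).
exists a; split=> //; first by exists b.
move=> tau tau0; have [N _ /(_ N (leqnn N)) /= wN] := pow2_small tau0.
pose E k := D (k + N)%N; pose K : set X := ~` (\bigcup_k E k).
have oU : open (\bigcup_k E k : set X) by apply: bigcup_open => k _; exact: oD.
have mE k : measurable (E k) by exact: open_borel (oD (k + N)%N).
have KD x k : K x -> (N <= k)%N -> ~ D k x.
  by move=> Kx Nk Dx; apply: Kx; exists (k - N)%N => //; rewrite /E subnK.
exists K; split.
- by apply: subclosed_compact cX _ => //; exact: open_closedC.
- move=> eps eps0; have eps30 : 0 < eps / 3 by rewrite divr_gt0.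
  have [M NM wM] : exists2 M, (N <= M)%N & 2 * w M < eps / 3.
    have [M _ HM] := pow2_small eps30; exists (maxn N M); first exact: leq_maxl.
    exact: HM _ (leq_maxr N M).
  have [r r0 Hr] := iter_unif_dist (\sum_(0 <= i < M) b i)%N eps30.
  exists r => // x y Kx Ky xy n.
  have [s [_ ss] <-] : FS b (a n) by rewrite -aE; exists n.
  (* The cut [L] exceeds every entry of [s] and is at least [M]. *)
  pose L := (M + (\sum_(i <- s) i).+1)%N.
  have ML : (M <= L)%N by exact: leq_addr.
  have sL : all (fun i => i < L)%N s.
    apply/allP => i si; rewrite /L addnS ltnS; apply: leq_trans (leq_addl _ _).
    by rewrite (big_rem i)//= leq_addr.
  have us : uniq s by exact: (sorted_uniq ltn_trans ltnn ss).
  rewrite -(partial_sum_all b us sL).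
  have tail z : K z -> mdist (iter (partial_sum b s L) T z)
                             (iter (partial_sum b s M) T z) < eps / 3.
    move=> Kz; apply: le_lt_trans wM; apply: le_trans (IP_tail _ _ ML) _.
      by move=> k j Mk; apply: HD; apply: KD => //; exact: leq_trans Mk.
    by rewrite gerBl mulr_ge0// exprn_ge0.
  have := Hr _ (partial_sum_le b s M) _ _ xy.
  have := tail _ Kx; have := tail _ Ky.
  move: (partial_sum b s L) (partial_sum b s M) => l m.
  have := metric_triangle (iter l T x) (iter m T x) (iter l T y).
  have := metric_triangle (iter m T x) (iter m T y) (iter l T y).
  by rewrite (metric_sym (iter m T y) (iter l T y)); lra.
have mU : measurable (\bigcup_k E k) by exact: bigcup_measurable.
have muU : (mu (\bigcup_k E k) <= (2 * w N)%:E)%E.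
  apply: le_trans (generalized_Boole_inequality mu mE mU) _.
  have w0 : 0 <= 2 * w N by rewrite mulr_ge0// exprn_ge0.
  apply: le_trans (epsilon_trick0 xpredT w0).
  apply: lee_nneseries => // i _; apply: le_trans (muD _) _.
  rewrite lee_fin exprD natrX exprS invfM !exprVn mulrACA divff// mul1r.
  by rewrite mulrC.
rewrite probability_setC// lteBrDr ?fin_num_measure//.
apply: le_lt_trans (leeD2l _ muU) _; rewrite -EFinD lte_fin; lra.
Qed.

End IP.

Theorem theorem1p3 (R : realType) (X : pmetricType R) (T : X -> X)
    (mu : probability (borelType X) R)
    (hX : compact [set: X]) (hT : homeomorphism T)
    (hmu : invariant_regular T mu) :
  [<-> rigid mu T;
       exists a : nat -> nat,
         subsequence a /\ measure_equicontinuous_along mu T a;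
       exists a : nat -> nat,
         [/\ subsequence a, IP_set (range a)
           & measure_equicontinuous_along mu T a]].
Proof.
have [cT _] := hT; have [iT reg] := hmu.
have ip_of_rec := recurrent_IP (mu := mu) hX cT.
have rec_of_eq a := equicontinuous_recurrent (a := a) hX cT iT.
tfae.
- by move=> /(rigid_recurrent hX cT)/ip_of_rec[a [sa _ eqa]]; exists a.
- by move=> [a [sa eqa]]; exact/ip_of_rec/(rec_of_eq a).
- move=> [a [sa _ eqa]].
  exact: (recurrent_rigid reg cT iT (rec_of_eq a sa eqa)).
Qed.
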